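(* (1) Every unary query computable by a 2-GNN all of whose layers use $\mathrm{MAX}$ aggregation is computable by a 1-GNN all of whose layers use $\mathrm{MAX}$ aggregation. (2) Every unary query computable by a 2-GNN all of whose layers use $\mathrm{MEAN}$ aggregation is computable by a 1-GNN all of whose layers use $\mathrm{MEAN}$ aggregation.
   Context: Graphs are finite, simple, undirected; an $\ell$-labelled graph has unary relations $P_1,\dots,P_\ell$ and is identified with the Boolean signal $\mathcal b:V(G)\to\{0,1\}^\ell$, $\mathcal b(v)_i=1\iff v\in P_i(G)$. A unary query maps each $\ell$-labelled graph $G$ to an isomorphism-invariant set $\mathcal Q(G)\subseteq V(G)$. An FNN is a composition of layers $\vec x\mapsto\sigma(A\vec x+\vec b)$ with rational $A,\vec b$ and $\sigma\in\{\mathrm{ReLU},\mathrm{id}\}$ applied coordinatewise. A 1-GNN layer is a triple $(\mathrm{msg},\mathrm{agg},\mathrm{comb})$ with $\mathrm{msg}:\mathbb R^p\to\mathbb R^r$, $\mathrm{comb}:\mathbb R^{p+r}\to\mathbb R^q$ computed by FNNs and $\mathrm{agg}\in\{\mathrm{SUM},\mathrm{MEAN},\mathrm{MAX}\}$ (coordinatewise sum, arithmetic mean, maximum over a finite multiset; $\vec 0$ on the empty multiset), mapping a signal $\mathcal f$ to $\mathcal f'(v)=\mathrm{comb}\big(\mathcal f(v),\mathrm{agg}(\{\!\{\mathrm{msg}(\mathcal f(w)):w\in N_G(v)\}\!\})\big)$; a 2-GNN layer is the same with $\mathrm{msg}:\mathbb R^{2p}\to\mathbb R^r$ and messages $\mathrm{msg}(\mathcal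 f(v),\mathcal f(w))$. An $i$-GNN is a sequence of $i$-GNN layers with matching dimensions computing their composition; $S_{\mathfrak N}(G,\mathcal b)$ is its output. A GNN $\mathfrak N$ with input dimension $\ell$ and output dimension $1$ computes $\mathcal Q$ if for all $\ell$-labelled $G$ and $v\in V(G)$: $S_{\mathfrak N}(G,\mathcal b)(v)\ge3/4$ if $v\in\mathcal Q(G)$ and $\le 1/4$ otherwise. *)

(* Defs.v *)
From mathcomp Require Import all_boot all_order all_algebra.
From mathcomp Require Import reals.

Set Implicit Arguments.
Unset Strict Implicit.
Unset Printing Implicit Defensive.
Import Order.TTheory GRing.Theory Num.Theory.
Local Open Scope ring_scope.

Record lgraph (l : nat) := LGraph {
  vert : finType;
  edge : rel vert;
  edge_sym : symmetric edge;
  edge_irr : irreflexive edge;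
  label : 'I_l -> {set vert}
}.

Definition neighbours (l : nat) (G : lgraph l) (v : vert G) : {set vert G} :=
  [set w | edge v w].

Definition lgraph_iso (l : nat) (G H : lgraph l) (h : vert G -> vert H) : Prop :=
  [/\ bijective h,
      forall v w, edge (h v) (h w) = edge v w &
      forall i v, (h v \in label H i) = (v \in label G i)].

Record unary_query (l : nat) := UnaryQuery {
  query :> forall G : lgraph l, {set vert G};
  query_iso : forall (G H : lgraph l) (h : vert G -> vert H),
    lgraph_iso h -> forall v, (h v \in query H) = (v \in query G)
}.

Inductive activation := ReLU | Id.

Record fnn_layer (p q : nat) := FnnLayer {
  weight : 'M[rat]_(q, p);
  bias : 'cV[rat]_q;
  act : activation
}.

(* [fnn p q]: nonempty sequences of layers with matching dimensions, from
   input dimension p to output dimension q; the head is applied first. *)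
Inductive fnn : nat -> nat -> Type :=
| FnnLast p q of fnn_layer p q : fnn p q
| FnnCons p q r of fnn_layer p q & fnn q r : fnn p r.

Definition act_fun (R : realType) (s : activation) (x : R) : R :=
  match s with ReLU => Num.max 0 x | Id => x end.

Definition fnn_layer_eval (R : realType) (p q : nat) (L : fnn_layer p q)
    (x : 'cV[R]_p) : 'cV[R]_q :=
  map_mx (act_fun (act L))
    (map_mx ratr (weight L) *m x + map_mx ratr (bias L)).

Fixpoint fnn_eval (R : realType) (p q : nat) (F : fnn p q) :
    'cV[R]_p -> 'cV[R]_q :=
  match F with
  | FnnLast _ _ L => fun x => fnn_layer_eval L x
  | FnnCons _ _ _ L F' => fun x => fnn_eval F' (fnn_layer_eval L x)
  end.

Inductive aggregation := SUM | MEAN | MAX.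

(* The finite multiset is given by an enumeration of its elements with
   multiplicities; the result does not depend on their order.  In the MEAN
   case the empty sequence yields 0 because [0^-1 *: 0 = 0]. *)
Definition aggregate (R : realType) (a : aggregation) (r : nat)
    (s : seq 'cV[R]_r) : 'cV[R]_r :=
  match a with
  | SUM => \sum_(x <- s) x
  | MEAN => (size s)%:R^-1 *: \sum_(x <- s) x
  | MAX => if s is x :: s' then
             \col_i \big[Num.max/x i 0]_(y <- s') y i 0
           else 0
  end.

Inductive gnn_kind := OneGNN | TwoGNN.

Definition msg_dim (k : gnn_kind) (p : nat) : nat :=
  match k with OneGNN => p | TwoGNN => (p + p)%N end.

(* [x] is the state of the receiving vertex, [y] that of its neighbour. *)
Definition msg_arg (R : realType) (k : gnn_kind) (p : nat) (x y : 'cV[R]_p) :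
    'cV[R]_(msg_dim k p) :=
  match k with OneGNN => y | TwoGNN => col_mx x y end.

Record gnn_layer (k : gnn_kind) (p q : nat) := GnnLayer {
  rdim : nat;
  msg : fnn (msg_dim k p) rdim;
  agg : aggregation;
  comb : fnn (p + rdim) q
}.

Definition signal (R : realType) (l : nat) (G : lgraph l) (p : nat) : Type :=
  vert G -> 'cV[R]_p.

Definition label_signal (R : realType) (l : nat) (G : lgraph l) :
    signal R G l :=
  fun v => \col_i (v \in label G i)%:R.
Arguments label_signal R {l} G _.

Definition gnn_layer_eval (R : realType) (l : nat) (G : lgraph l)
    (k : gnn_kind) (p q : nat) (L : gnn_layer k p q) (f : signal R G p) :
    signal R G q :=
  fun v => fnn_eval (comb L)
    (col_mx (f v)
       (aggregate (agg L)
          [seq fnn_eval (msg L) (msg_arg k (f v) (f w))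
             | w <- enum (neighbours v)])).

Inductive gnn (k : gnn_kind) : nat -> nat -> Type :=
| GnnLast p q of gnn_layer k p q : gnn k p q
| GnnCons p q r of gnn_layer k p q & gnn k q r : gnn k p r.

Fixpoint gnn_eval (R : realType) (l : nat) (G : lgraph l) (k : gnn_kind)
    (p q : nat) (N : gnn k p q) : signal R G p -> signal R G q :=
  match N with
  | GnnLast _ _ L => fun f => gnn_layer_eval L f
  | GnnCons _ _ _ L N' => fun f => gnn_eval N' (gnn_layer_eval L f)
  end.

Fixpoint all_layers_use (a : aggregation) (k : gnn_kind) (p q : nat)
    (N : gnn k p q) : Prop :=
  match N with
  | GnnLast _ _ L => agg L = a
  | GnnCons _ _ _ L N' => agg L = a /\ all_layers_use a N'
  end.

Definition computes (R : realType) (l : nat) (k : gnn_kind) (N : gnn k l 1)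
    (Q : unary_query l) : Prop :=
  forall (G : lgraph l) (v : vert G),
    let y : R := gnn_eval N (label_signal R G) v 0 0 in
    (v \in Q G -> 3 / 4 <= y) /\ (v \notin Q G -> y <= 1 / 4).

Definition computable_by (R : realType) (k : gnn_kind) (a : aggregation)
    (l : nat) (Q : unary_query l) : Prop :=
  exists N : gnn k l 1, all_layers_use a N /\ computes R N Q.

(* Main.v *)
(* For MAX and MEAN, the aggregate is 1-Lipschitz in the messages for the sup
   norm, uniformly in the degree.  Hence at a 2-GNN layer the function
   [x |-> agg_w msg (x, f w)] is Lipschitz, with a constant [K] independent of
   the graph.  A 1-GNN layer can send [msg (x_u, f w)] for all points [x_u] of a
   fine rational grid, so that the receiver, in state [x], obtains the values of
   this function on the grid and recovers its value at [x] up to a small error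
   by McShane's formula [max_u (a_u - K |x - x_u|)], which an FNN computes
   exactly.  All states stay in a bounded set independent of the graph and all
   layers are Lipschitz, so the errors of successive layers can be made
   arbitrarily small; the gap between 1/4 and 3/4 absorbs them. *)
Require Import Defs.
From mathcomp Require Import all_boot all_order all_algebra.
From mathcomp Require Import reals.
From mathcomp Require Import ring lra.

Set Implicit Arguments.
Unset Strict Implicit.
Unset Printing Implicit Defensive.
Import Order.TTheory GRing.Theory Num.Theory.
Local Open Scope ring_scope.

(** * Closure properties of the functions computed exactly by FNNs *)

Section FnnComputable.
Context (R : realType).

(** A property of functions, so that the networks needed later arise from closure properties without
    their weights being written out. *)
Definition fnn_computable (p q : nat) (g : 'cV[R]_p -> 'cV[R]_q) : Prop :=
  exists F : fnn p q, fnn_eval F =1 g.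

Definition fnn_computable_scalar (p : nat) (s : 'cV[R]_p -> R) : Prop :=
  fnn_computable (fun x => const_mx (s x) : 'cV_1).

Lemma eq_fnn_computable p q (g h : 'cV[R]_p -> 'cV[R]_q) :
  g =1 h -> fnn_computable g -> fnn_computable h.
Proof. by move=> gh [F Fg]; exists F => x; rewrite Fg. Qed.

Lemma fnn_computable_eval p q (F : fnn p q) :
  fnn_computable (fun x : 'cV[R]_p => fnn_eval F x).
Proof. by exists F. Qed.

Lemma fnn_computable_layer p q (L : fnn_layer p q) :
  fnn_computable (fun x : 'cV[R]_p => fnn_layer_eval L x).
Proof. by exists (FnnLast L). Qed.

Lemma fnn_computable_comp p q r (g : 'cV[R]_p -> 'cV[R]_q)
    (h : 'cV[R]_q -> 'cV[R]_r) :
  fnn_computable g -> fnn_computable h -> fnn_computable (fun x => h (g x)).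
Proof.
move=> [F Fg] hh; apply: (@eq_fnn_computable _ _ (fun x => h (fnn_eval F x))).
  by move=> x; rewrite Fg.
elim: F r h hh {g Fg} => [p1 q1 L|p1 q1 r1 L F IH] r h hh.
  by case: hh => H Hh; exists (FnnCons L H) => x /=; rewrite Hh.
by case: (IH _ _ hh) => H Hh; exists (FnnCons L H) => x /=; rewrite Hh.
Qed.

Lemma fnn_computable_affine p q (W : 'M[rat]_(q, p)) (b : 'cV[rat]_q) :
  fnn_computable (fun x : 'cV[R]_p => map_mx ratr W *m x + map_mx ratr b).
Proof.
apply: eq_fnn_computable (fnn_computable_layer (FnnLayer W b Id)) => x.
by apply/matrixP => i j; rewrite mxE.
Qed.

Lemma fnn_computable_linear p q (W : 'M[rat]_(q, p)) :
  fnn_computable (fun x : 'cV[R]_p => map_mx ratr W *m x).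
Proof.
apply: eq_fnn_computable (fnn_computable_affine W 0) => x.
by rewrite map_mx0 addr0.
Qed.

Lemma fnn_computable_layer_carry p q k (L : fnn_layer p q) :
  fnn_computable (fun z : 'cV[R]_(p + k) =>
    col_mx (fnn_layer_eval L (usubmx z)) (dsubmx z)).
Proof.
case: L => W b [].
  (* [z = max 0 z - max 0 (- z)] carries [z] through a ReLU layer. *)
  pose U : 'M[rat]_(q + (k + k), p + k) :=
    col_mx (row_mx W 0) (col_mx (row_mx 0 1%:M) (row_mx 0 (- 1%:M))).
  pose V : 'M[rat]_(q + k, q + (k + k)) :=
    block_mx 1%:M 0 0 (row_mx 1%:M (- 1%:M)).
  have := fnn_computable_comp
    (fnn_computable_layer (FnnLayer U (col_mx b 0) ReLU))
    (fnn_computable_linear V).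
  apply: eq_fnn_computable => z.
  rewrite -{1}[z]vsubmxK /fnn_layer_eval /= /U /V.
  rewrite !(map_col_mx, map_row_mx, map_block_mx, map_mx0, map_mx1, map_mxN).
  rewrite !mul_col_mx !mul_row_col !mul0mx !mulNmx !mul1mx !addr0 !add0r.
  rewrite !add_col_mx addr0 !map_col_mx !mul_row_col !mul0mx !mulNmx !mul1mx.
  rewrite addr0 add0r.
  congr col_mx; apply/colP => i; rewrite !mxE /=.
  by rewrite /Num.max; do 2!case: ifP => ?; lra.
pose U : 'M[rat]_(q + k, p + k) := block_mx W 0 0 1%:M.
apply: eq_fnn_computable (fnn_computable_affine U (col_mx b 0)) => z.
rewrite -{1}[z]vsubmxK /fnn_layer_eval /= /U.
rewrite map_block_mx map_col_mx !map_mx0 map_mx1 mul_block_col.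
rewrite !mul0mx !mul1mx !addr0 !add0r add_col_mx addr0.
by congr col_mx; apply/colP => i; rewrite !mxE.
Qed.

Lemma fnn_computable_carry p q k (g : 'cV[R]_p -> 'cV[R]_q) :
  fnn_computable g -> fnn_computable (fun z : 'cV[R]_(p + k) =>
    col_mx (g (usubmx z)) (dsubmx z)).
Proof.
move=> [F Fg]; apply: (@eq_fnn_computable _ _
  (fun z => col_mx (fnn_eval F (usubmx z)) (dsubmx z))).
  by move=> x; rewrite Fg.
elim: F {g Fg} => [p1 q1 L|p1 q1 r1 L F IH] /=.
  exact: fnn_computable_layer_carry.
apply: eq_fnn_computable
  (fnn_computable_comp (fnn_computable_layer_carry k L) IH) => z.
by rewrite col_mxKu col_mxKd.
Qed.

Lemma fnn_computable_swap p q :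
  fnn_computable (fun z : 'cV[R]_(p + q) => col_mx (dsubmx z) (usubmx z)).
Proof.
apply: eq_fnn_computable
  (fnn_computable_linear (block_mx 0 1%:M 1%:M 0)) => z.
rewrite -{1}[z]vsubmxK map_block_mx !map_mx0 !map_mx1 mul_block_col.
by rewrite !mul0mx !mul1mx addr0 add0r.
Qed.

(** The two networks may differ in depth, so they run one after the other: duplicate the input,
    apply [g] to one copy while carrying the other, swap, apply [h] while carrying the result of
    [g], and swap back. *)
Lemma fnn_computable_col_mx p q r (g : 'cV[R]_p -> 'cV[R]_q)
    (h : 'cV[R]_p -> 'cV[R]_r) :
  fnn_computable g -> fnn_computable h ->
  fnn_computable (fun x => col_mx (g x) (h x)).
Proof.
move=> cg ch.
have cdup : fnn_computable (fun x : 'cV[R]_p => col_mx x x).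
  apply: eq_fnn_computable
    (fnn_computable_linear (col_mx 1%:M 1%:M : 'M_(p + p, p))) => x.
  by rewrite map_col_mx !map_mx1 mul_col_mx !mul1mx.
apply: eq_fnn_computable (fnn_computable_comp
  (fnn_computable_comp
    (fnn_computable_comp cdup (fnn_computable_carry p cg))
    (fnn_computable_comp (fnn_computable_swap _ _)
      (fnn_computable_carry q ch)))
  (fnn_computable_swap _ _)) => x.
by rewrite !(col_mxKu, col_mxKd).
Qed.

Lemma eq_fnn_computable_scalar p (s t : 'cV[R]_p -> R) :
  s =1 t -> fnn_computable_scalar s -> fnn_computable_scalar t.
Proof. by move=> st; apply: eq_fnn_computable => x; rewrite st. Qed.

Lemma fnn_computable_scalar_entry p q (g : 'cV[R]_p -> 'cV[R]_q) i :
  fnn_computable g -> fnn_computable_scalar (fun x => g x i 0).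
Proof.
move=> /fnn_computable_comp /(_ (fnn_computable_linear (row i 1%:M))).
apply: eq_fnn_computable => x.
by rewrite map_row map_mx1 -row_mul mul1mx; apply/colP => j; rewrite !mxE.
Qed.

Lemma fnn_computable_scalar_proj p i :
  fnn_computable_scalar (fun x : 'cV[R]_p => x i 0).
Proof.
apply: fnn_computable_scalar_entry.
apply: eq_fnn_computable (fnn_computable_linear 1%:M) => x.
by rewrite map_mx1 mul1mx.
Qed.

Lemma fnn_computable_entries p q (g : 'cV[R]_p -> 'cV[R]_q) :
  (forall i, fnn_computable_scalar (fun x => g x i 0)) -> fnn_computable g.
Proof.
elim: q g => [|q IH] g cg.
  apply: eq_fnn_computable (fnn_computable_linear 0) => x.
  by apply/colP => -[].
(* As [q.+1] is convertible to [1 + q], the first coordinate can be stacked on the remaining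
   ones. *)
apply: eq_fnn_computable (fnn_computable_col_mx (cg ord0)
  (IH (fun x => \col_i g x (rshift 1 i) 0) _)) => [x|i].
  apply/colP => i; case: (@split_ordP 1 q i) => j ->.
    by rewrite (@col_mxEu _ 1 q) mxE; congr (g x _ 0); apply/val_inj; case: j => -[].
  by rewrite (@col_mxEd _ 1 q) mxE.
by apply: eq_fnn_computable_scalar (cg (rshift 1 i)) => x; rewrite mxE.
Qed.

Lemma fnn_computable_scalar_const p (c : rat) :
  fnn_computable_scalar (fun _ : 'cV[R]_p => ratr c).
Proof.
apply: eq_fnn_computable (fnn_computable_affine 0 (const_mx c)) => x.
by rewrite map_mx0 mul0mx add0r map_const_mx.
Qed.

Lemma fnn_computable_scalar_lincomb p (a b : rat) (s t : 'cV[R]_p -> R) :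
  fnn_computable_scalar s -> fnn_computable_scalar t ->
  fnn_computable_scalar (fun x => ratr a * s x + ratr b * t x).
Proof.
move=> cs ct.
apply: eq_fnn_computable (fnn_computable_comp (fnn_computable_col_mx cs ct)
  (fnn_computable_linear (row_mx a%:M b%:M))) => x.
rewrite map_row_mx !map_scalar_mx mul_row_col !mul_scalar_mx.
by apply/colP => i; rewrite !mxE.
Qed.

(** By the identity [max s t = max 0 (s - t) + t]. *)
Lemma fnn_computable_scalar_max p (s t : 'cV[R]_p -> R) :
  fnn_computable_scalar s -> fnn_computable_scalar t ->
  fnn_computable_scalar (fun x => Num.max (s x) (t x)).
Proof.
move=> cs ct.
have := fnn_computable_comp (fnn_computable_scalar_lincomb 1 (-1) cs ct)
  (fnn_computable_layer (FnnLayer 1%:M 0 ReLU)).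
move=> /fnn_computable_scalar_entry - /(_ ord0) cr.
have := fnn_computable_scalar_lincomb 1 1 cr ct.
apply: eq_fnn_computable_scalar => x /=.
rewrite /fnn_layer_eval /= map_mx1 map_mx0 mul1mx addr0 !mxE /=.
by rewrite rmorphN !rmorph1 /Num.max; do 2!case: ifP => ?; lra.
Qed.

Lemma fnn_computable_scalar_norm p (s : 'cV[R]_p -> R) :
  fnn_computable_scalar s -> fnn_computable_scalar (fun x => `|s x|).
Proof.
move=> cs; have := fnn_computable_scalar_max cs
  (fnn_computable_scalar_lincomb (-1) 0 cs cs).
apply: eq_fnn_computable_scalar => x /=.
by rewrite rmorphN rmorph1 rmorph0 mul0r addr0 mulN1r maxrN.
Qed.

Lemma fnn_computable_scalar_sum p (I : Type) (r : seq I)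
    (s : I -> 'cV[R]_p -> R) :
  (forall i, fnn_computable_scalar (s i)) ->
  fnn_computable_scalar (fun x => \sum_(i <- r) s i x).
Proof.
move=> cs; elim: r => [|i r IH].
  apply: eq_fnn_computable_scalar (fnn_computable_scalar_const p 0) => x.
  by rewrite big_nil rmorph0.
apply: eq_fnn_computable_scalar
  (fnn_computable_scalar_lincomb 1 1 (cs i) IH) => x.
by rewrite big_cons !rmorph1 !mul1r.
Qed.

Lemma fnn_computable_scalar_bigmax p (I : Type) (r : seq I) (i0 : I)
    (s : I -> 'cV[R]_p -> R) :
  (forall i, fnn_computable_scalar (s i)) ->
  fnn_computable_scalar (fun x => \big[Num.max/s i0 x]_(i <- r) s i x).
Proof.
move=> cs; elim: r => [|i r IH].
  by apply: eq_fnn_computable_scalar (cs i0) => x; rewrite big_nil.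
apply: eq_fnn_computable_scalar (fnn_computable_scalar_max (cs i) IH) => x.
by rewrite big_cons.
Qed.

End FnnComputable.

(** * Sup-norm estimates for FNNs, aggregation and GNNs *)

Section Closeness.
Context (R : realType).

Definition close (p : nat) (e : R) (x y : 'cV[R]_p) : Prop :=
  forall i, `|x i 0 - y i 0| <= e.

(** The constant is a natural number so that it can later serve as a rational weight of a
    network. *)
Definition lipschitz (p q K : nat) (g : 'cV[R]_p -> 'cV[R]_q) : Prop :=
  forall e x y, 0 <= e -> close e x y -> close (K%:R * e) (g x) (g y).

Lemma le_close p (d e : R) (x y : 'cV[R]_p) :
  d <= e -> close d x y -> close e x y.
Proof. by move=> de xy i; apply: le_trans (xy i) de. Qed.

Lemma close_refl p (e : R) (x : 'cV[R]_p) : 0 <= e -> close e x x.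
Proof. by move=> e0 i; rewrite subrr normr0. Qed.

Lemma close_trans p (d e : R) (y x z : 'cV[R]_p) :
  close d x y -> close e y z -> close (d + e) x z.
Proof.
move=> xy yz i; apply: le_trans (lerD (xy i) (yz i)).
by apply: le_trans (ler_normD _ _); rewrite addrA subrK.
Qed.

Lemma close_col_mx p q (e : R) (x x' : 'cV[R]_p) (y y' : 'cV[R]_q) :
  close e x x' -> close e y y' -> close e (col_mx x y) (col_mx x' y').
Proof.
move=> xx yy i; case: (split_ordP i) => j ->.
  by rewrite !col_mxEu.
by rewrite !col_mxEd.
Qed.

(** [g x] is within [K * B] of [g 0], whose entries are at most the sum [s] of their absolute
    values. *)
Lemma lipschitz_bounded p q K (g : 'cV[R]_p -> 'cV[R]_q) :
  lipschitz K g -> forall B : nat, exists M : nat,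
    forall x, close B%:R x 0 -> close M%:R (g x) 0.
Proof.
move=> gK B; pose s := \sum_i `|g 0 i 0|.
exists (K * B + Num.bound s)%N => x xB; rewrite natrD natrM.
apply: close_trans (gK _ _ _ (ler0n _ _) xB) _ => i.
rewrite mxE subr0; apply: (@le_trans _ _ s).
  by rewrite /s (bigD1 i) //= lerDl sumr_ge0.
by apply/ltW/archi_boundP/sumr_ge0.
Qed.

Lemma ler_dist_max (e a b c d : R) :
  `|a - c| <= e -> `|b - d| <= e -> `|Num.max a b - Num.max c d| <= e.
Proof.
rewrite !ler_distl => /andP[? ?] /andP[? ?].
by rewrite /Num.max; do 2!case: ifP => ?; apply/andP; split; lra.
Qed.

Lemma fnn_layer_lipschitz p q (L : fnn_layer p q) :
  exists K : nat, lipschitz K (fnn_layer_eval L : 'cV[R]_p -> _).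
Proof.
(* The sum of all absolute weights dominates every row sum; both activations are 1-Lipschitz. *)
pose s : R := \sum_i \sum_j `|ratr (weight L i j)|.
have s0 : 0 <= s by apply: sumr_ge0 => i _; apply: sumr_ge0.
exists (Num.bound s) => e x y e0 xy i.
apply: (@le_trans _ _ (s * e)); last first.
  by rewrite ler_wpM2r // ltW // archi_boundP.
rewrite /fnn_layer_eval !mxE.
have lin : `|\sum_j map_mx ratr (weight L) i j * x j 0 + ratr (bias L i 0) -
    (\sum_j map_mx ratr (weight L) i j * y j 0 + ratr (bias L i 0))| <= s * e.
  rewrite opprD addrACA subrr addr0 -sumrB.
  apply: le_trans (ler_norm_sum _ _ _) _.
  apply: (@le_trans _ _ ((\sum_j `|ratr (weight L i j)|) * e)).
    rewrite mulr_suml; apply: ler_sum => j _.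
    by rewrite mxE -mulrBr normrM ler_wpM2l.
  rewrite ler_wpM2r // /s [leRHS](bigD1 i) //= lerDl.
  by apply: sumr_ge0 => ? _; apply: sumr_ge0.
case: (act L) => //=; apply: ler_dist_max => //.
by rewrite subrr normr0 mulr_ge0.
Qed.

Lemma lipschitz_comp p q r K M (g : 'cV[R]_p -> 'cV[R]_q)
    (h : 'cV[R]_q -> 'cV[R]_r) :
  lipschitz K g -> lipschitz M h -> lipschitz (M * K) (fun x => h (g x)).
Proof.
move=> gK hM e x y e0 xy; rewrite natrM -mulrA.
by apply: hM; [rewrite mulr_ge0|apply: gK].
Qed.

Lemma fnn_lipschitz p q (F : fnn p q) :
  exists K : nat, lipschitz K (fnn_eval F : 'cV[R]_p -> _).
Proof.
elim: F => [p1 q1 L|p1 q1 r1 L F [M IH]]; first exact: fnn_layer_lipschitz.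
have [K LK] := fnn_layer_lipschitz L.
by exists (M * K)%N; apply: lipschitz_comp LK IH.
Qed.

(** Means and maxima do not amplify a uniform error, whatever the length of [s]; a sum would
    multiply it by that length. Dimensions and indices may differ on the two sides because an entry
    of a sampled message will be compared with an entry of the original one. *)
Lemma aggregate_entry_close a p q (T : Type) (s : seq T)
    (g : T -> 'cV[R]_p) (h : T -> 'cV[R]_q) i j e :
  a <> SUM -> 0 <= e -> (forall w, `|g w i 0 - h w j 0| <= e) ->
  `|aggregate a (map g s) i 0 - aggregate a (map h s) j 0| <= e.
Proof.
case: a => // _ e0 gh /=.
  rewrite !mxE !size_map !summxE !big_map -mulrBr -sumrB normrM.
  (* Empty neighbourhood: the factor [0^-1] is 0. *)
  have [->|s0] := eqVneq (size s) 0%N; first by rewrite invr0 normr0 mul0r.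
  rewrite ger0_norm ?invr_ge0 // ler_pdivrMl ?ltr0n ?lt0n //.
  apply: le_trans (ler_norm_sum _ _ _) _.
  apply: le_trans (ler_sum _ (fun w _ => gh w)) _.
  by rewrite big_const_seq count_predT iter_addr_0 mulr_natl.
case: s => [|w s] /=; first by rewrite !mxE subrr normr0.
rewrite !mxE !big_map.
apply: (big_rec2 (fun x y : R => `|x - y| <= e)) => // *.
exact: ler_dist_max.
Qed.

(** Lets a bound on an aggregate be read as closeness to the aggregate of zero messages. *)
Lemma aggregate_zero a r (T : Type) (s : seq T) :
  aggregate a (map (fun _ => 0 : 'cV[R]_r) s) = 0.
Proof.
have sum0 : \sum_(x <- map (fun _ => 0 : 'cV[R]_r) s) x = 0.
  by rewrite big_map big1.
case: a => //=; first by rewrite sum0 scaler0.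
case: s {sum0} => //= _ s; apply/colP => i; rewrite !mxE big_map.
by elim: s => [|w s IH]; rewrite ?big_nil // big_cons IH mxE maxxx.
Qed.

Lemma gnn_layer_lipschitz k p q (L : gnn_layer k p q) : agg L <> SUM ->
  exists K : nat, forall (l : nat) (G : lgraph l) (e : R) (f g : signal R G p),
    0 <= e -> (forall v, close e (f v) (g v)) ->
    forall v, close (K%:R * e) (gnn_layer_eval L f v) (gnn_layer_eval L g v).
Proof.
move=> La; have [M msgM] := fnn_lipschitz (msg L).
have [K combK] := fnn_lipschitz (comb L).
(* The input of [comb] has error [e] in the state and [M * e] in the aggregate; [M.+1 * e] covers
   both. The constant is fixed before the graph. *)
exists (K * M.+1)%N => l G e f g e0 fg v; rewrite natrM -mulrA.
apply: combK; first by rewrite mulr_ge0.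
rewrite -addn1 natrD mulrDl mul1r.
have Me0 : 0 <= M%:R * e by rewrite mulr_ge0.
apply: close_col_mx; first by apply: le_close (fg v); rewrite lerDr.
apply: (@le_close _ (M%:R * e)); first by rewrite lerDl.
move=> i; apply: aggregate_entry_close => // w; apply: msgM => //.
by case: (k) => //=; apply: close_col_mx.
Qed.

Lemma gnn_layer_bounded k p q (L : gnn_layer k p q) (B : nat) :
  agg L <> SUM ->
  exists M : nat, forall (l : nat) (G : lgraph l) (f : signal R G p),
    (forall v, close B%:R (f v) 0) ->
    forall v, close M%:R (gnn_layer_eval L f v) 0.
Proof.
move=> La; have [K msgK] := fnn_lipschitz (msg L).
have [M msgM] := lipschitz_bounded msgK B.
have [K' combK] := fnn_lipschitz (comb L).
have [M' combM] := lipschitz_bounded combK (B + M).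
exists M' => l G f fB v; apply: combM.
rewrite natrD -[0]vsubmxK !linear0; apply: close_col_mx.
  by apply: le_close (fB v); rewrite lerDl.
apply: (@le_close _ M%:R); first by rewrite lerDr.
move=> i; rewrite -(aggregate_zero (agg L) _ (enum (neighbours v))).
apply: aggregate_entry_close => // w; apply: msgM.
case: (k) => //=; rewrite -[0]vsubmxK !linear0.
exact: close_col_mx.
Qed.

Lemma gnn_lipschitz a k p q (N : gnn k p q) : a <> SUM -> all_layers_use a N ->
  exists K : nat, forall (l : nat) (G : lgraph l) (e : R) (f g : signal R G p),
    0 <= e -> (forall v, close e (f v) (g v)) ->
    forall v, close (K%:R * e) (gnn_eval N f v) (gnn_eval N g v).
Proof.
move=> aS; elim: N => [p1 q1 L|p1 q1 r1 L N IH] /=.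
  by move=> La; apply: gnn_layer_lipschitz; rewrite La.
move=> [La /IH[K NK]].
have [|M LM] := @gnn_layer_lipschitz _ _ _ L; first by rewrite La.
exists (K * M)%N => l G e f g e0 fg v; rewrite natrM -mulrA.
by apply: NK; [rewrite mulr_ge0|apply: LM].
Qed.

(** * Sampling on a rational grid and McShane reconstruction *)

Lemma rational_grid p (B n : nat) :
  exists (I : finType) (i0 : I) (grid : I -> 'cV[rat]_p),
    forall x : 'cV[R]_p, close B%:R x 0 ->
      exists u, close (n.+1%:R^-1) x (map_mx ratr (grid u)).
Proof.
(* Each coordinate ranges over [[-B, B]] in [m] steps of length [1 / n.+1]; a point is rounded down
   to the grid. *)
pose m := (2 * B * n.+1)%N.
exists {ffun 'I_p -> 'I_m.+1}, [ffun=> ord0].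
exists (fun u : {ffun 'I_p -> 'I_m.+1} => \col_i ((u i)%:R / n.+1%:R - B%:R)) => x xB.
pose t i : R := (x i 0 + B%:R) * n.+1%:R.
have n0 : 0 < n.+1%:R :> R by rewrite ltr0n.
exists [ffun i => inord (Num.truncn (t i))] => i.
have := xB i; rewrite mxE subr0 ler_norml => /andP[x1 x2].
have t0 : 0 <= t i by apply: mulr_ge0; [lra|exact: ltW].
have /andP[t1 t2] := truncn_itv t0.
have tm : (Num.truncn (t i) < m.+1)%N.
  rewrite ltnS -(ler_nat R); apply: le_trans t1 _.
  by rewrite /m !natrM ler_wpM2r //; lra.
rewrite !mxE ffunE inordK // rmorphB fmorph_div !rmorph_nat.
set y := (Num.truncn (t i))%:R in t1 t2 *.
have -> : x i 0 - (y / n.+1%:R - B%:R) = (t i - y) / n.+1%:R.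
  by rewrite /t mulrBl mulfK ?gt_eqF //; ring.
rewrite normrM [`|_^-1|]ger0_norm ?invr_ge0 // ler_piMl ?invr_ge0 //.
rewrite ger0_norm ?subr_ge0 //.
by move: t2; rewrite -natr1 -/y; lra.
Qed.

(* The maximum over [u] of [a u - d u] is McShane's extension of the values
   [a u] sampled from a Lipschitz function, evaluated at a point where the
   function is [A]; [d u] is the variation allowed from sample [u]. *)
Lemma mcshane_extension_close (I : finType) (i0 : I) (a d : I -> R) (A e : R) :
  (forall u, `|a u - A| <= d u) -> (exists u, d u <= e) ->
  `|\big[Num.max/a i0 - d i0]_u (a u - d u) - A| <= 2 * e.
Proof.
move=> aA [u ue]; have le_A w : a w - d w <= A.
  by have := aA w; rewrite ler_distl => /andP[_ ?]; lra.
have := aA u; rewrite ler_distl => /andP[au _].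
have e0 : 0 <= e by apply: le_trans (normr_ge0 _) (le_trans (aA u) ue).
have up : \big[Num.max/a i0 - d i0]_w (a w - d w) <= A by apply: bigmax_le.
(* At this [u] the term [a u - d u] is at least [A - 2 * d u], hence at least [A - 2 * e]. *)
have lo := le_bigmax (a i0 - d i0) (fun w => a w - d w) u.
by rewrite ler_distl; apply/andP; split; lra.
Qed.

End Closeness.

(** * Approximating 2-GNNs by 1-GNNs with the same aggregation *)

Lemma gnn_layer_approx (R : realType) p q (L : gnn_layer TwoGNN p q)
    (B : nat) (eps : R) :
  agg L <> SUM -> 0 < eps ->
  exists L' : gnn_layer OneGNN p q, agg L' = agg L /\
    forall (l : nat) (G : lgraph l) (f : signal R G p),
      (forall v, close B%:R (f v) 0) ->
      forall v, close eps (gnn_layer_eval L' f v) (gnn_layer_eval L f v).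
Proof.
case: L => r msg a comb /= aS eps0.
have [K msgK] := fnn_lipschitz R msg.
have [M combM] := fnn_lipschitz R comb.
(* With mesh [1 / n.+1], the nearest sample has [dist] at most [K * p / n.+1]; reconstruction
   doubles this and [comb] multiplies it by [M]. The choice of [n] brings the result below [eps]. *)
pose n := Num.bound (M%:R * (2 * (K%:R * p%:R)) / eps).
have [I [i0 [grid gridP]]] := rational_grid R p B n.
pose pt u : 'cV[R]_p := map_mx ratr (grid u).
(* The sum norm dominates the sup norm, at the cost of the factor [p]. *)
pose dist (x : 'cV[R]_p) u := K%:R * \sum_k `|x k 0 - pt u k 0|.
pose J := (I * 'I_r)%type.
pose rk u c : 'I_#|{: J}| := enum_rank ((u, c) : J).
(* The new message: every entry of the old one, with each grid point in turn in place of the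
   receiver's state. *)
pose sample (y : 'cV[R]_p) : 'cV[R]_#|{: J}| := \col_j
  fnn_eval msg (col_mx (pt (enum_val j).1) y) (enum_val j).2 0.
pose recover (z : 'cV[R]_(p + #|{: J}|)) : 'cV[R]_q := fnn_eval comb
  (col_mx (usubmx z) (\col_c
    \big[Num.max/dsubmx z (rk i0 c) 0 - dist (usubmx z) i0]_u
      (dsubmx z (rk u c) 0 - dist (usubmx z) u))).
have [F1 F1E] : fnn_computable sample.
  apply: fnn_computable_entries => j.
  apply: (@eq_fnn_computable_scalar _ _ (fun y =>
    fnn_eval msg (col_mx (pt (enum_val j).1) y) (enum_val j).2 0)).
    by move=> y; rewrite mxE.
  apply: fnn_computable_scalar_entry.
  apply: (fnn_computable_comp (g := fun y => col_mx (pt (enum_val j).1) y)).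
    apply: fnn_computable_col_mx; apply: fnn_computable_entries => i.
      apply: eq_fnn_computable_scalar
        (fnn_computable_scalar_const R _ (grid (enum_val j).1 i 0)) => y.
      by rewrite mxE.
    exact: fnn_computable_scalar_proj.
  exact: fnn_computable_eval.
have usub_computable i : fnn_computable_scalar
    (fun z : 'cV[R]_(p + #|{: J}|) => usubmx z i 0).
  apply: eq_fnn_computable_scalar
    (fnn_computable_scalar_proj R (lshift _ i)) => z.
  by rewrite mxE.
have term_computable u c : fnn_computable_scalar
    (fun z : 'cV[R]_(p + #|{: J}|) =>
       dsubmx z (rk u c) 0 - dist (usubmx z) u).
  have sum_computable : fnn_computable_scalar
      (fun z : 'cV[R]_(p + #|{: J}|) =>
         \sum_k `|usubmx z k 0 - pt u k 0|).
    apply: (@fnn_computable_scalar_sum R _ _ _ (fun k z =>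
      `|usubmx z k 0 - pt u k 0|)) => k.
    apply: fnn_computable_scalar_norm.
    have := fnn_computable_scalar_lincomb 1 (-1) (usub_computable k)
      (fnn_computable_scalar_const R _ (grid u k 0)).
    apply: eq_fnn_computable_scalar => z.
    by rewrite rmorphN !rmorph1 mul1r mulN1r /pt !mxE.
  have := fnn_computable_scalar_lincomb 1 (- K%:R)
    (fnn_computable_scalar_proj R (rshift p (rk u c))) sum_computable.
  apply: eq_fnn_computable_scalar => z.
  by rewrite rmorphN !rmorph1 rmorph_nat mul1r mulNr [dsubmx _ _ _]mxE.
have [F2 F2E] : fnn_computable recover.
  apply: fnn_computable_comp (fnn_computable_eval R comb).
  apply: fnn_computable_col_mx; apply: fnn_computable_entries => i.
    exact: usub_computable.
  have := fnn_computable_scalar_bigmax (index_enum I) i0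
    (fun u => term_computable u i).
  by apply: eq_fnn_computable_scalar => z; rewrite [RHS]mxE.
exists (@GnnLayer OneGNN p q _ F1 a F2); split=> // l G f fB v.
rewrite /gnn_layer_eval /= F2E /recover col_mxKu col_mxKd.
have n0 : 0 < n.+1%:R :> R by rewrite ltr0n.
have e0 : 0 <= 2 * (K%:R * (p%:R / n.+1%:R)) :> R.
  by rewrite !mulr_ge0 // invr_ge0 ltW.
apply: (@le_close _ _ (M%:R * (2 * (K%:R * (p%:R / n.+1%:R))))).
  have -> : M%:R * (2 * (K%:R * (p%:R / n.+1%:R))) =
      M%:R * (2 * (K%:R * p%:R)) / n.+1%:R :> R by rewrite !mulrA.
  rewrite ler_pdivrMr // [eps * _]mulrC -ler_pdivrMr //.
  apply: (@le_trans _ _ n%:R); last by rewrite ler_nat.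
  by apply/ltW/archi_boundP; rewrite !mulr_ge0 // invr_ge0 ltW.
apply: combM => //; apply: close_col_mx; first exact: close_refl.
(* Coordinate by coordinate, [A] is the true aggregate and [a u] the one sampled at [pt u]. Each
   pair of messages differs by at most [dist (f v) u], hence so do the aggregates. *)
move=> c; rewrite mxE; apply: mcshane_extension_close => [u|].
  apply: aggregate_entry_close => // [|w].
    by rewrite mulr_ge0 ?sumr_ge0.
  rewrite F1E /sample mxE /rk enum_rankK /=.
  apply: msgK; first by rewrite sumr_ge0.
  apply: close_col_mx; last by apply: close_refl; rewrite sumr_ge0.
  move=> k; rewrite distrC (bigD1 k) //= lerDl.
  by rewrite sumr_ge0.
have [u xu] := gridP _ (fB v); exists u; rewrite /dist ler_wpM2l //.
apply: le_trans (ler_sum _ (fun k _ => xu k)) _.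
by rewrite sumr_const card_ord mulr_natl.
Qed.

(** Induction on the layers. The new tail, run on the perturbed states, errs by at most [eps / 2];
    the original tail is Lipschitz and turns the error [d] of the first layer into at most another
    [eps / 2]. *)
Lemma gnn_approx (R : realType) a p q (N : gnn TwoGNN p q) :
  a <> SUM -> all_layers_use a N ->
  forall (B : nat) (eps : R), 0 < eps ->
  exists N' : gnn OneGNN p q, all_layers_use a N' /\
    forall (l : nat) (G : lgraph l) (f : signal R G p),
      (forall v, close B%:R (f v) 0) ->
      forall v, close eps (gnn_eval N' f v) (gnn_eval N f v).
Proof.
move=> aS; elim: N => [p1 q1 L|p1 q1 r1 L N IH] /=.
  move=> La B eps eps0.
  have [|L' [L'a L'L]] := gnn_layer_approx (L := L) B _ eps0.
    by rewrite La.
  by exists (GnnLast L'); split; [rewrite /= L'a|].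
move=> [La Na] B eps eps0.
have LS : agg L <> SUM by rewrite La.
have [K NK] := gnn_lipschitz R aS Na.
have [M LM] := gnn_layer_bounded R B LS.
have eps2 : 0 < eps / 2 by rewrite divr_gt0.
(* The approximate first layer leaves the bound [M] by at most [d <= 1], so the tail must be good up
   to [M.+1]. *)
have [N' [N'a N'N]] := IH Na M.+1 _ eps2.
(* [K.+1] keeps the divisor positive when [K] is 0. *)
pose d := Num.min 1 (eps / 2 / K.+1%:R).
have d0 : 0 < d by rewrite lt_min ltr01 divr_gt0.
have [L' [L'a L'L]] := gnn_layer_approx B LS d0.
exists (GnnCons L' N'); split; first by rewrite /= L'a.
move=> l G f fB v /=.
apply: (@le_close _ _ (eps / 2 + K%:R * d)).
  have : K%:R * d <= eps / 2.
    apply: (@le_trans _ _ (K.+1%:R * d)); first by rewrite ler_pM2r ?ler_nat.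
    by rewrite mulrC -ler_pdivlMr // ge_min lexx orbT.
  lra.
apply: close_trans (N'N _ _ _ _ v) (NK _ _ _ _ _ (ltW d0) (L'L _ _ _ fB) v).
move=> w; rewrite -addn1 natrD addrC.
apply: close_trans (LM _ _ _ fB w).
by apply: le_close (L'L _ _ _ fB w); rewrite ge_min lexx.
Qed.

(** * Rescaling the output and restoring the thresholds *)

Lemma gnn_postcomp (R : realType) a k p q r (N : gnn k p q) (F : fnn q r) :
  all_layers_use a N ->
  exists N' : gnn k p r, all_layers_use a N' /\
    forall (l : nat) (G : lgraph l) (f : signal R G p) v,
      gnn_eval N' f v = fnn_eval F (gnn_eval N f v).
Proof.
elim: N F => [p1 q1 L|p1 q1 r1 L N IH] F /=.
  (* The [comb] of the last layer absorbs [F], so no layer is added. *)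
  have [H HE] := fnn_computable_comp (fnn_computable_eval R (comb L))
    (fnn_computable_eval R F).
  move=> La; exists (GnnLast (GnnLayer (msg L) (agg L) H)).
  by split=> // l G f v; rewrite /= /gnn_layer_eval /= HE.
move=> [La /(IH F)[N' [N'a N'E]]].
by exists (GnnCons L N'); split=> // l G f v /=.
Qed.

Lemma computable_by_OneGNN (R : realType) a (l : nat) (Q : unary_query l) :
  a <> SUM -> computable_by R TwoGNN a Q -> computable_by R OneGNN a Q.
Proof.
move=> aS [N [Na NQ]].
have eps0 : 0 < 1 / 8 :> R by lra.
(* The bound 1 suffices because label signals are Boolean. *)
have [N1 [N1a N1N]] := gnn_approx aS Na 1 eps0.
(* [y |-> 2 y - 1/2] restores the thresholds [3/4] and [1/4] from [5/8] and
   [3/8]. *)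
pose T : fnn 1 1 := FnnLast (FnnLayer (2%:M) (const_mx (- (1 / 2))) Id).
have [N2 [N2a N2E]] := gnn_postcomp R T N1a.
exists N2; split=> // G v /=.
have fB w : close 1%:R (label_signal R G w) 0.
  by move=> i; rewrite !mxE subr0; case: (_ \in _); rewrite ?normr1 ?normr0.
have /(_ 0) := N1N _ _ _ fB v.
have [] := NQ G v; rewrite N2E /= /fnn_layer_eval /= map_scalar_mx mul_scalar_mx.
rewrite !mxE rmorphN fmorph_div rmorph1 !rmorph_nat ler_distl /=.
by move=> yes no /andP[? ?]; split=> [/yes|/no] ?; lra.
Qed.

Theorem theorem5p9 (R : realType) :
  (forall (l : nat) (Q : unary_query l),
     computable_by R TwoGNN MAX Q -> computable_by R OneGNN MAX Q) /\
  (forall (l : nat) (Q : unary_query l),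
     computable_by R TwoGNN MEAN Q -> computable_by R OneGNN MEAN Q).
Proof. by split=> l Q; apply: computable_by_OneGNN. Qed.
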